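(* Let $\lambda\in\mathbb{R}$, and let either $N\geq3$ and $1<p\leq 2^\star-1$ with $2^\star=\frac{2N}{N-2}$, or $N=2$ and $1<p<\infty$. Assume $\theta<0$. Then there is no positive solution $u$ of $$\Delta_{\mathbb{B}^N}u+\lambda u+|u|^{p-1}u+\theta u\ln u^2=0\quad\text{in }\mathbb{B}^N$$ satisfying $u(x)\approx(1-|x|^2)^\alpha$ for some $\alpha>0$; that is, there is no positive solution $u$ for which there exist $\alpha>0$ and $C\geq1$ (possibly depending on $u$) such that $C^{-1}(1-|x|^2)^\alpha\leq u(x)\leq C(1-|x|^2)^\alpha$ for all $x\in\mathbb{B}^N$.
   Context: $\mathbb{B}^N$ is the ball model of hyperbolic $N$-space: the Euclidean unit ball with the metric $g=\left(\frac{2}{1-|x|^2}\right)^2dx^2$; $\Delta_{\mathbb{B}^N}$, $\nabla_{\mathbb{B}^N}$, $dV_{\mathbb{B}^N}$ are its Laplace–Beltrami operator, gradient and volume element; $|x|$ is the Euclidean norm. Solution: $u\in H^1_{loc}(\mathbb{B}^N)$ is a (weak) solution if for all $\phi\in C_c^\infty(\mathbb{B}^N)$ $$\int_{\mathbb{B}^N}\langle\nabla_{\mathbb{B}^N}u,\nabla_{\mathbb{B}^N}\phi\rangle_g\,dV_{\mathbb{B}^N}-\lambda\int_{\mathbb{B}^N}u\phi\,dV_{\mathbb{B}^N}=\theta\int_{\mathbb{B}^N}\phi\,u\ln u^2\,dV_{\mathbb{B}^N}+\int_{\mathbb{B}^N}\phi|u|^{p-1}u\,dV_{\mathbb{B}^N}.$$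 Weak solutions are smooth by local elliptic regularity. No global integrability of $u$ is assumed. *)

(* Defs.v *)
From HB Require Import structures.
From mathcomp Require Import all_boot all_order all_algebra.
From mathcomp Require Import all_classical all_reals all_analysis.

Set Implicit Arguments.
Unset Strict Implicit.
Unset Printing Implicit Defensive.

Import Order.TTheory GRing.Theory Num.Theory.
Import numFieldNormedType.Exports.

Local Open Scope classical_set_scope.
Local Open Scope ring_scope.

(* Row vectors carry the product sigma-algebra, generated by the coordinates;
   for real entries these are the Borel sets. *)

Definition measure_row_display : measure_display -> measure_display.
Proof. exact. Qed.

Section measurable_row.
Context {d} {T : measurableType d}.
Variable n : nat.

Let coors : 'I_n -> 'rV[T]_n -> T := fun i v => v ord0 i.

Let row_set0 : g_sigma_preimage coors set0.
Proof. exact: sigma_algebra0. Qed.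

Let row_setC A : g_sigma_preimage coors A -> g_sigma_preimage coors (~` A).
Proof. exact: sigma_algebraC. Qed.

Let row_bigcup (F : _^nat) : (forall i, g_sigma_preimage coors (F i)) ->
  g_sigma_preimage coors (\bigcup_i (F i)).
Proof. exact: sigma_algebra_bigcup. Qed.

HB.instance Definition _ := @isMeasurable.Build (measure_row_display d)
  ('rV[T]_n) (g_sigma_preimage coors) row_set0 row_setC row_bigcup.

Definition row_of_tuple (t : n.-tuple T) : 'rV[T]_n := \row_i tnth t i.

Lemma measurable_row_of_tuple : measurable_fun [set: n.-tuple T] row_of_tuple.
Proof.
have E : (fun i => coors i \o row_of_tuple) = fun i (t : n.-tuple T) => tnth t i.
  by apply/funext => i; apply/funext => t; rewrite /coors /= mxE.
have := g_sigma_preimage_comp coors row_of_tuple.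
rewrite E => H _ B mB.
have : g_sigma_preimage (fun i (t : n.-tuple T) => tnth t i)
    (setT `&` row_of_tuple @^-1` B) by rewrite H; exists B.
exact.
Qed.

End measurable_row.

Section lebesgue_row.
Variable R : realType.

Definition tuple_cons n (p : n.-tuple R * measurableTypeR R) : n.+1.-tuple R :=
  [tuple of (p.2 : R) :: p.1].

Lemma measurable_tuple_cons n : measurable_fun setT (@tuple_cons n).
Proof. exact: (measurable_cons measurable_snd measurable_fst). Qed.

Local Notation image_measure :=
  measure_function_pushforward__canonical__measure_function_Measure.

Fixpoint lebesgue_tuple n : {measure set (n.-tuple R) -> \bar R} :=
  match n with
  | 0%N => \d_([tuple] : 0.-tuple R)
  | n'.+1 => image_measure
      (lebesgue_tuple n' \x lebesgue_measure)%E (@measurable_tuple_cons n')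
  end.

Definition lebesgue_row n : {measure set ('rV[R]_n) -> \bar R} :=
  image_measure (lebesgue_tuple n) (@measurable_row_of_tuple _ _ n).

End lebesgue_row.

Section ball_model.
Variables (R : realType) (N : nat).
Notation E := 'rV[R]_N.
Notation leb := (lebesgue_row R N).

Definition dotv (v w : E) : R := \sum_i v ord0 i * w ord0 i.

(* The library norm on ['rV[R]_N] is the sup norm. *)
Definition enorm (x : E) : R := Num.sqrt (dotv x x).

Definition hball : set E := [set x | enorm x < 1].

Definition conf (x : E) : R := 2 / (1 - enorm x ^+ 2).

Definition hmetric (x v w : E) : R := conf x ^+ 2 * dotv v w.

(* Riemannian gradient, obtained by raising the index of the Euclidean one. *)
Definition hgrad (G : E -> E) (x : E) : E := (conf x ^+ 2)^-1 *: G x.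

Definition hint (f : E -> R) : R :=
  \int[leb]_(x in hball) (f x * conf x ^+ N).

Definition pderiv (i : 'I_N) (f : E -> R) (x : E) : R :=
  'D_(delta_mx ord0 i) f x.

Definition egrad (f : E -> R) (x : E) : E := \row_i pderiv i f x.

Fixpoint Ck (k : nat) (f : E -> R) : Prop :=
  match k with
  | 0%N => continuous f
  | k'.+1 => (forall x, differentiable f x) /\ forall i, Ck k' (pderiv i f)
  end.

Definition smooth (f : E -> R) : Prop := forall k, Ck k f.

(* Elements of C_c^oo(hball), extended by 0 to the whole space. *)
Definition test_function (phi : E -> R) : Prop :=
  smooth phi /\
  exists K : set E, [/\ compact K, K `<=` hball & forall x, ~ K x -> phi x = 0].

Definition L2_loc (f : E -> R) : Prop :=
  measurable_fun hball f /\
  forall K : set E, compact K -> K `<=` hball ->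
    leb.-integrable K (EFin \o (fun x => f x ^+ 2)).

Definition weak_egrad (u : E -> R) (G : E -> E) : Prop :=
  forall (phi : E -> R) (i : 'I_N), test_function phi ->
    \int[leb]_(x in hball) (u x * pderiv i phi x) =
    - \int[leb]_(x in hball) (G x ord0 i * phi x).

(* [u] is in H^1_loc(hball), with weak Euclidean gradient [G]. *)
Definition H1_loc_with (u : E -> R) (G : E -> E) : Prop :=
  [/\ L2_loc u, (forall i, L2_loc (fun x => G x ord0 i)) & weak_egrad u G].

(* [Rintegral] is total, but every integrand below is integrable when [u] is in
   H^1_loc and [p] is at most the critical exponent (Sobolev embedding). *)
Definition weak_solution (lambda theta p : R) (u : E -> R) : Prop :=
  exists G : E -> E, H1_loc_with u G /\
    forall phi : E -> R, test_function phi ->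
      hint (fun x => hmetric x (hgrad G x) (hgrad (egrad phi) x))
        - lambda * hint (fun x => u x * phi x) =
      theta * hint (fun x => phi x * (u x * ln (u x ^+ 2)))
        + hint (fun x => phi x * (`|u x| `^ (p - 1) * u x)).

End ball_model.

Definition two_star (R : realType) (N : nat) : R := 2 * N%:R / (N%:R - 2).

(* Main.v *)
From HB Require Import structures.
Require Import Defs.
From mathcomp Require Import all_boot all_order all_algebra.
From mathcomp Require Import all_classical all_reals all_analysis.
From mathcomp Require Import measurable_realfun ring lra.

Import Order.TTheory GRing.Theory Num.Theory.
Import numFieldNormedType.Exports.

Local Open Scope classical_set_scope.
Local Open Scope ring_scope.

(** A solution with [u <= C (1 - |x|^2)^alpha] tends to [0] at the boundary, so,
    as [theta < 0], the potential
    [V = lambda + u^(p-1) + theta ln u^2] in [- Delta u = V u] tends to [+oo]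
    there.  On the other hand there is one constant [Lambda], independent of the
    position, such that nonnegative test functions [phi] with
    [- Delta phi <= Lambda phi] are supported in the shells
    [a <= 1 - |x|^2 <= 2 a] for every small [a]: up to rescaling they are
    [exp (- 1 / q)] for a concave parabola [q] in [1 - |x|^2].  Once
    [V >= Lambda + 1] on the shell, testing the equation with [phi] gives
    [(Lambda + 1) int u phi <= int V u phi = int u (- Delta phi) <= Lambda int u phi],
    which contradicts [int u phi > 0]. *)

(** * Functions of one variable *)

Section one_variable.
Context {R : realType}.
Implicit Types (f g h : R -> R) (k m : nat) (a t : R).

(** The derivative is an existential witness rather than ['D_1 h], so that closed formulas can be
    supplied and later extracted together with their continuity. *)
Fixpoint C1k k h : Prop :=
  if k is k'.+1 then
    exists h', (forall t, is_derive t 1 h (h' t)) /\ C1k k' h'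
  else continuous h.

Lemma is_derive_continuous f t (f' : R) : is_derive t 1 f f' -> {for t, continuous f}.
Proof.
by move=> [df _]; apply: differentiable_continuous; exact/derivable1_diffP.
Qed.

Lemma C1k_continuous k h : C1k k h -> continuous h.
Proof. by case: k => [//|k] [h' [dh _]] t; exact: is_derive_continuous (dh t). Qed.

Lemma C1kW k h : C1k k.+1 h -> C1k k h.
Proof.
elim: k h => [|k IH] h; first exact: C1k_continuous.
by move=> [h' [dh /IH Ch']]; exists h'.
Qed.

Lemma C1k_cst k (c : R) : C1k k (fun=> c).
Proof.
elim: k c => [|k IH] c; first by move=> t; exact: cvg_cst.
by exists (fun=> 0); split => // t; exact: is_derive_cst.
Qed.

Lemma C1kD k f g : C1k k f -> C1k k g -> C1k k (fun t => f t + g t).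
Proof.
elim: k f g => [|k IH] f g; first by move=> cf cg t; apply: cvgD; [exact: cf|exact: cg].
move=> [f' [df Cf]] [g' [dg Cg]]; exists (fun t => f' t + g' t); split; last exact: IH.
by move=> t; exact: is_deriveD.
Qed.

Lemma C1kM k f g : C1k k f -> C1k k g -> C1k k (fun t => f t * g t).
Proof.
elim: k f g => [|k IH] f g; first by move=> cf cg t; apply: cvgM; [exact: cf|exact: cg].
move=> Cf Cg; have [Wf Wg] := (C1kW _ _ Cf, C1kW _ _ Cg).
move: Cf Cg => [f' [df Cf]] [g' [dg Cg]].
exists (fun t => f t * g' t + g t * f' t); split.
  by move=> t; exact: is_deriveM.
by apply: C1kD; apply: IH.
Qed.

Lemma C1k_comp k f g : C1k k f -> C1k k g -> C1k k (f \o g).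
Proof.
elim: k f g => [|k IH] f g.
  by move=> cf cg t; apply: continuous_comp; [exact: cg|exact: cf].
move=> [f' [df Cf]] Cg; have Wg := C1kW _ _ Cg; move: Cg => [g' [dg Cg]].
exists (fun t => f' (g t) * g' t); split.
  by move=> t; exact: (is_derive1_comp (df (g t)) (dg t)).
by apply: C1kM => //; exact: (IH f' g).
Qed.

Lemma is_derive_inv t : t != 0 -> is_derive t 1 GRing.inv (- t^-1 ^+ 2 : R).
Proof.
move=> t0; have H := @is_deriveV R id t 1 1 t0 (is_derive_id _ _).
by apply: (is_derive_eq H); rewrite /= /GRing.scale /= mulr1 exprVn.
Qed.

(** The singularity at 0 is invisible: the quotient vanishes near every [t < a], and [t] is nonzero
    elsewhere. The derivative [h' / t - h / t / t] is built from quotients of the same kind, because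
    [h'] also vanishes below [a]; hence the induction. *)
Lemma C1k_divl k h a : 0 < a -> (forall t, t < a -> h t = 0) -> C1k k h ->
  C1k k (fun t => h t / t).
Proof.
move=> a0; have Z h0 t : t < a -> (forall t, t < a -> h0 t = 0) ->
    \forall x \near t, 0 = h0 x / x.
  move=> ta hz; near=> x; rewrite hz ?mul0r//.
  by near: x; exact: lt_nbhsl.
have Q t : a <= t -> t != 0 by move=> at0; rewrite gt_eqF// (lt_le_trans a0).
elim: k h => [|k IH] h hz Ch.
  move=> t; have [ta|/Q t0] := ltP t a.
    apply: (is_derive_continuous _ _ 0).
    exact: (near_eq_is_derive (Z h t ta hz) (is_derive_cst _ _ _)).
  by apply: cvgM; [exact: Ch|exact: inv_continuous].
have Wh := C1kW _ _ Ch; case: Ch => h' [dh Ch].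
have hz' t : t < a -> h' t = 0.
  move=> ta; have [_ <-] := dh t; transitivity ('D_1 (cst 0 : R -> R) t).
    apply: near_eq_derive; near=> x; rewrite hz//.
    by near: x; exact: lt_nbhsl.
  by rewrite derive_cst.
exists (fun t => h' t / t + (- 1) * (h t / t / t)); split.
  move=> t; have [ta|/Q t0] := ltP t a.
    apply: (@near_eq_is_derive _ _ _ (cst 0) _ _ _ _ (Z h t ta hz)).
    rewrite hz// hz'// !mul0r mulr0 addr0.
    exact: is_derive_cst.
  have H := is_deriveM (dh t) (is_derive_inv t t0).
  apply: (is_derive_eq H); rewrite /GRing.scale /=; field; exact: t0.
apply: C1kD; first exact: IH.
apply: C1kM; first exact: C1k_cst.
apply: (IH (fun t => h t / t)); last exact: IH.
by move=> t ta; rewrite hz// mul0r.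
Unshelve. all: by end_near. Qed.

Lemma C1k_divX k n h a : 0 < a -> (forall t, t < a -> h t = 0) -> C1k k h ->
  C1k k (fun t => h t / t ^+ n).
Proof.
move=> a0; elim: n h => [|n IH] h hz Ch.
  by under eq_fun do rewrite expr0 divr1.
under eq_fun do rewrite exprS invfM mulrA.
apply: (IH (fun t => h t / t)); last exact: (C1k_divl _ _ _ a0 hz Ch).
by move=> t ta; rewrite hz// mul0r.
Qed.

(* The powers of [1/t] make the family closed under differentiation. *)
Definition expinv m t : R := if 0 < t then t^-1 ^+ m * expR (- t^-1) else 0.

(** With [v = 1 / t], a single term of the exponential series gives [v^(m+1) / (m+1)! <= exp v].
    This linear bound is what yields differentiability at 0. *)
Lemma expinv_le m t : 0 <= t -> expinv m t <= m.+1`!%:R * t.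
Proof.
move=> t0; rewrite /expinv; case: ifPn => [tp|_]; last by rewrite mulr_ge0.
have v0 : 0 <= t^-1 by rewrite invr_ge0.
have := expR_ge1Dxn m v0; have := expR_gt0 t^-1; rewrite expRN.
set e := expR _ => e0 H; rewrite ler_pdivrMr//.
have F : 0 < m.+1`!%:R :> R by rewrite ltr0n fact_gt0.
have : t^-1 ^+ m.+1 / m.+1`!%:R <= e by apply: le_trans H; rewrite lerDr.
rewrite ler_pdivrMr// exprS => H2.
rewrite -(@ler_pM2l _ t^-1) ?invr_gt0//; apply: (le_trans H2).
by rewrite [leRHS](_ : _ = e * m.+1`!%:R)//; field; rewrite gt_eqF.
Qed.

Lemma expinv_ge0 m t : 0 <= expinv m t.
Proof.
rewrite /expinv; case: ifPn => // t0.
by rewrite mulr_ge0 ?expR_ge0 ?exprn_ge0 ?invr_ge0 ?ltW.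
Qed.

Lemma is_derive_expinv m t :
  is_derive t 1 (expinv m) (- m%:R * expinv m.+1 t + expinv m.+2 t).
Proof.
have [t0|t0|->] := ltgtP t 0.
- rewrite /expinv !ltNge (ltW t0) /= mulr0 addr0.
  suff H : \forall x \near t, 0 = (if 0 < x then x^-1 ^+ m * expR (- x^-1) else 0).
    exact: near_eq_is_derive H (is_derive_cst _ _ _).
  near=> x; suff: x < 0 by move=> /ltW; rewrite leNgt => /negbTE ->.
  by near: x; exact: lt_nbhsl.
- have D := is_derive_inv t (lt0r_neq0 t0).
  have DX := @is_deriveX R R (fun x : R => x^-1) m t 1 _ D.
  have DE := @is_derive1_comp _ expR (fun x : R => - x^-1) t _ _
    (is_derive_expR _) (is_deriveN D).
  have H := is_deriveM DX DE.
  rewrite {2 3}/expinv t0; apply: (@near_eq_is_derive _ _ _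
    (((fun x : R => x^-1) ^+ m : R -> R) * (expR \o (fun x : R => - x^-1)))).
    near=> x; rewrite /expinv ifT; last by near: x; exact: lt_nbhsr.
    by rewrite [LHS]/GRing.mul /= fctE.
  apply: (is_derive_eq H); rewrite /GRing.scale /= !fctE.
  case: m {DX H} => [|m]; first by rewrite !expr0 !mul0r; ring.
  by rewrite /= !exprS; ring.
- rewrite /expinv ltxx mulr0 addr0.
  suff H : (fun y : R => y^-1 *: ((expinv m \o shift 0) (y *: 1) - expinv m 0))
      @ 0^' --> (0 : R).
    by apply: DeriveDef; [apply/cvg_ex; exists 0|apply: cvg_lim H].
  apply/cvgr0Pnorm_le => e e0; near=> x.
  rewrite /= /GRing.scale /= mulr1 addr0 [in X in _ - X]/expinv ltxx subr0.
  (* The difference quotient at 0 is the next member of the family, which tends to 0 by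
     [expinv_le]. *)
  have -> : x^-1 * expinv m x = expinv m.+1 x.
    by rewrite /expinv; case: ifP; rewrite ?mulr0// exprS mulrA.
  rewrite ger0_norm ?expinv_ge0//.
  have [x0|x0] := ltP 0 x; last by rewrite /expinv ltNge x0 /= ltW.
  apply: le_trans (expinv_le _ _ (ltW x0)) _.
  rewrite mulrC -ler_pdivlMr ?ltr0n ?fact_gt0//.
  rewrite -[x]gtr0_norm//; near: x; apply: dnbhs0_le.
  by rewrite divr_gt0// ltr0n fact_gt0.
Unshelve. all: by end_near. Qed.

Lemma C1k_expinv k m : C1k k (expinv m).
Proof.
elim: k m => [|k IH] m.
  by move=> t; exact: is_derive_continuous (is_derive_expinv m t).
exists (fun t => - m%:R * expinv m.+1 t + expinv m.+2 t); split.
  exact: is_derive_expinv.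
by apply: C1kD => //; apply: C1kM => //; exact: C1k_cst.
Qed.

End one_variable.

(** * Functions of several variables *)

Section several_variables.
Context {R : realType} {N : nat}.
Notation E := 'rV[R]_N.
Implicit Types (f g s : E -> R) (h : R -> R) (k : nat) (x : E) (i : 'I_N).

Lemma Ck_continuous k f : Ck k f -> continuous f.
Proof.
by case: k => [//|k] [df _] x; exact: differentiable_continuous (df x).
Qed.

Lemma CkW k f : Ck k.+1 f -> Ck k f.
Proof.
elim: k f => [|k IH] f; first exact: Ck_continuous.
by move=> [df Cf]; split => // i; exact: IH.
Qed.

Lemma pderivD i f g x : differentiable f x -> differentiable g x ->
  pderiv i (fun y => f y + g y) x = pderiv i f x + pderiv i g x.
Proof. by move=> df dg; apply: deriveD; exact: diff_derivable. Qed.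

Lemma pderivM i f g x : differentiable f x -> differentiable g x ->
  pderiv i (fun y => f y * g y) x = f x * pderiv i g x + g x * pderiv i f x.
Proof. by move=> df dg; apply: deriveM; exact: diff_derivable. Qed.

Lemma pderiv_comp i h s x (d : R) : is_derive (s x) 1 h d -> differentiable s x ->
  differentiable (h \o s) x /\ pderiv i (h \o s) x = d * pderiv i s x.
Proof.
move=> [dh <-] ds; have Dh : differentiable h (s x) by exact/derivable1_diffP.
have D : differentiable (h \o s) x by exact: differentiable_comp.
split => //; rewrite /pderiv !deriveE// diff_comp//= diff1E//.
by rewrite ?derive1E /GRing.scale /= ?mul1r mulrC.
Qed.

Lemma pderiv_coord i j x : pderiv i (fun y => y ord0 j) x = (i == j)%:R.
Proof.
have L : linear (fun y : E => y ord0 j) by move=> a u v; rewrite !mxE.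
pose f : {linear E -> R} := HB.pack (fun y : E => y ord0 j)
  (GRing.isLinear.Build _ _ _ _ _ L).
rewrite /pderiv deriveE; last exact: differentiable_coord.
rewrite (_ : (fun y : E => y ord0 j) = f)// diff_lin.
  by rewrite /f /= mxE eqxx eq_sym.
exact: coord_continuous.
Qed.

Lemma Ck_cst k (c : R) : Ck k (fun _ : E => c).
Proof.
elim: k c => [|k IH] c; first by exact: cst_continuous.
split => [x|i]; first exact: differentiable_cst.
suff -> : pderiv i (fun _ : E => c) = (fun=> 0) by exact: IH.
by apply/funext => x; exact: derive_cst.
Qed.

Lemma Ck_coord k i : Ck k (fun x : E => x ord0 i).
Proof.
case: k => [|k]; first by move=> x; exact: coord_continuous.
split => [x|j]; first exact: differentiable_coord.
suff -> : pderiv j (fun x : E => x ord0 i) = (fun=> (j == i)%:R) by exact: Ck_cst.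
by apply/funext => x; exact: pderiv_coord.
Qed.

Lemma CkD k f g : Ck k f -> Ck k g -> Ck k (fun x => f x + g x).
Proof.
elim: k f g => [|k IH] f g.
  by move=> cf cg x; exact: (continuousD (cf x) (cg x)).
move=> [df Cf] [dg Cg]; split => [x|i]; first exact: differentiableD.
rewrite (_ : pderiv i _ = fun x => pderiv i f x + pderiv i g x).
  exact: (IH _ _ (Cf i) (Cg i)).
by apply/funext => x; exact: pderivD.
Qed.

Lemma CkM k f g : Ck k f -> Ck k g -> Ck k (fun x => f x * g x).
Proof.
elim: k f g => [|k IH] f g.
  by move=> cf cg x; exact: (continuousM (cf x) (cg x)).
move=> Cf Cg; have [Wf Wg] := (CkW _ _ Cf, CkW _ _ Cg).
move: Cf Cg => [df Cf] [dg Cg]; split => [x|i]; first exact: differentiableM.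
rewrite (_ : pderiv i _ = fun x => f x * pderiv i g x + g x * pderiv i f x).
  by apply: CkD; [exact: (IH _ _ Wf (Cg i))|exact: (IH _ _ Wg (Cf i))].
by apply/funext => x; exact: pderivM.
Qed.

Lemma Ck_comp k h s : C1k k h -> Ck k s -> Ck k (h \o s).
Proof.
elim: k h => [|k IH] h.
  by move=> ch cs x; exact: (continuous_comp (cs x) (ch (s x))).
move=> [h' [dh Ch]] Cs; have Ws := CkW _ _ Cs; case: Cs => ds Cs.
split => [x|i].
  apply: differentiable_comp => //; apply/derivable1_diffP.
  by case: (dh (s x)).
rewrite (_ : pderiv i _ = fun x => (h' \o s) x * pderiv i s x).
  by apply: CkM; [exact: (IH _ Ch Ws)|exact: Cs].
by apply/funext => x; have [] := pderiv_comp i _ _ _ _ (dh (s x)) (ds x).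
Qed.

(** The variable in which radial functions are written: it is polynomial in [x], hence smooth at the
    origin, and [conf x] equals [2 / defect x]. *)
Definition defect x : R := 1 - dotv x x.

Lemma Ck_sum k (r : seq 'I_N) (F : 'I_N -> E -> R) :
  (forall i, Ck k (F i)) -> Ck k (fun x => \sum_(i <- r) F i x).
Proof.
move=> CF; elim: r => [|j r IH].
  by under eq_fun do rewrite big_nil; exact: Ck_cst.
by under eq_fun do rewrite big_cons; exact: CkD.
Qed.

Lemma Ck_defect k : Ck k defect.
Proof.
rewrite (_ : defect = fun x => 1 + (-1) * dotv x x).
  apply: CkD; first exact: Ck_cst.
  apply: CkM; first exact: Ck_cst.
  by apply: Ck_sum => i; apply: CkM; exact: Ck_coord.
by apply/funext => x; rewrite /defect mulN1r.
Qed.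

Lemma differentiable_defect x : differentiable defect x.
Proof. by have [] := Ck_defect 1. Qed.

Lemma differentiable_sum (r : seq 'I_N) (F : 'I_N -> E -> R) x :
  (forall i, differentiable (F i) x) ->
  differentiable (fun y => \sum_(i <- r) F i y) x /\
  forall j, pderiv j (fun y => \sum_(i <- r) F i y) x = \sum_(i <- r) pderiv j (F i) x.
Proof.
move=> dF; elim: r => [|i r [D IH]].
  under eq_fun do rewrite big_nil.
  by split => [|j]; [exact: differentiable_cst|rewrite big_nil; exact: derive_cst].
under eq_fun do rewrite big_cons; split => [|j]; first exact: differentiableD.
by rewrite big_cons -IH; exact: pderivD.
Qed.

Lemma pderiv_defect i x : pderiv i defect x = - 2 * x ord0 i.
Proof.
have dc j : differentiable (fun y : E => y ord0 j) x by exact: differentiable_coord.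
have [D P] := differentiable_sum (index_enum 'I_N) (fun i y => y ord0 i * y ord0 i) x
  (fun j => differentiableM (dc j) (dc j)).
rewrite /pderiv deriveB; last 2 first.
- exact: derivable_cst.
- exact: diff_derivable.
rewrite derive_cst sub0r [X in - X](P i).
under eq_bigr do rewrite (pderivM _ _ _ _ (dc _) (dc _)) !pderiv_coord.
rewrite (bigD1 i)//= eqxx big1 => [|j ji].
  by rewrite mulr1 addr0; ring.
by rewrite eq_sym (negbTE ji) mulr0 addr0.
Qed.

End several_variables.

(** * Lebesgue measure and integration on the ball *)

Section measure.
Context {R : realType}.

Lemma measurable_row_coord n (i : 'I_n) :
  measurable_fun setT (fun x : 'rV[R]_n => x ord0 i).
Proof.
move=> _ B mB; apply: sub_sigma_algebra.
rewrite -bigcup_seq/=.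
exists i; first by rewrite /= mem_index_enum.
by exists B.
Qed.

(** The measure is an iterated product, so the box splits into the box of the tail times [I 0].
    Indexing the sides by [nat] lets the induction pass to the shifted family [I i.+1]. *)
Lemma tuple_box n (I : nat -> set R) (r : R) :
  (forall i, measurable (I i)) -> (forall i, lebesgue_measure (I i) = r%:E) ->
  measurable [set t : n.-tuple R | forall i : 'I_n, I i (tnth t i)] /\
  lebesgue_tuple R n [set t : n.-tuple R | forall i : 'I_n, I i (tnth t i)] = (r ^+ n)%:E.
Proof.
elim: n I => [|n IHn] I mI rI; split.
- rewrite [X in measurable X](_ : _ = setT)//.
  by apply/seteqP; split => // t _ [].
- rewrite expr0 [X in lebesgue_tuple _ _ X](_ : _ = setT) /=.
    by rewrite diracT.
  by apply/seteqP; split => // t _ [].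
- rewrite [X in measurable X]
      (_ : _ = \bigcap_(i in [set: 'I_n.+1]) ((fun t => tnth t i) @^-1` I i)).
    apply: fin_bigcap_measurable => // i _.
    rewrite -[X in measurable X]setTI; exact: measurable_tnth.
  by apply/seteqP; split => [t Ht i _|t Ht i]; exact: Ht.
- have [mIH IH] := IHn (fun i => I i.+1) (fun i => mI i.+1) (fun i => rI i.+1).
  rewrite /= /pushforward.
  rewrite [X in (_ \x _)%E X](_ : _ =
      [set t : n.-tuple R | forall i : 'I_n, I i.+1 (tnth t i)] `*` I 0%N).
    rewrite product_measure1E//; last exact: mI.
    by rewrite exprS mulrC EFinM; congr (_ * _)%E; [exact: IH|exact: rI].
  apply/seteqP; split => [[t y] /= H|[t y] /= [H1 H2] i].
    split; last exact: (H ord0).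
    by move=> i; have := H (lift ord0 i); rewrite tnthS.
  by case: (unliftP ord0 i) => [j ->|->] //; rewrite tnthS; exact: H1.
Qed.

Lemma row_box n (I : nat -> set R) (r : R) :
  (forall i, measurable (I i)) -> (forall i, lebesgue_measure (I i) = r%:E) ->
  measurable [set x : 'rV[R]_n | forall i : 'I_n, I i (x ord0 i)] /\
  lebesgue_row R n [set x : 'rV[R]_n | forall i : 'I_n, I i (x ord0 i)] = (r ^+ n)%:E.
Proof.
move=> mI rI; split.
  rewrite [X in measurable X]
      (_ : _ = \bigcap_(i in [set: 'I_n]) ((fun t : 'rV[R]_n => t ord0 i) @^-1` I i)).
    apply: fin_bigcap_measurable => // i _.
    rewrite -[X in measurable X]setTI; exact: measurable_row_coord.
  by apply/seteqP; split => [t Ht i _|t Ht i]; exact: Ht.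
have [mB <-] := tuple_box n I r mI rI.
rewrite /lebesgue_row /= /pushforward; congr (lebesgue_tuple R n _).
by apply/seteqP; split => t /= H i; have := H i; rewrite mxE.
Qed.

End measure.

Section ball.
Context {R : realType} {N : nat}.
Notation E := 'rV[R]_N.
Notation leb := (lebesgue_row R N).
Notation B := (@hball R N).
Implicit Types (f g s : E -> R) (h : R -> R) (x : E) (i : 'I_N).

Lemma dotv_ge0 x : 0 <= dotv x x.
Proof. by apply: sumr_ge0 => i _; rewrite -expr2 sqr_ge0. Qed.

Lemma sqr_coord_le_dotv x i : x ord0 i ^+ 2 <= dotv x x.
Proof.
rewrite /dotv (bigD1 i)//= -expr2 lerDl.
by apply: sumr_ge0 => j _; rewrite -expr2 sqr_ge0.
Qed.

Lemma enorm_sqr x : enorm x ^+ 2 = dotv x x.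
Proof. by rewrite /enorm sqr_sqrtr ?dotv_ge0. Qed.

Lemma hballE x : hball x <-> 0 < defect x.
Proof.
rewrite /hball /= /enorm /defect subr_gt0 -{1}(@sqrtr1 R) ltr_sqrt//.
Qed.

Lemma defect_le1 x : defect x <= 1.
Proof. by rewrite /defect gerBl dotv_ge0. Qed.

Lemma conf_defect x : conf x = 2 / defect x.
Proof. by rewrite /conf enorm_sqr. Qed.

Lemma hball_coord x i : hball x -> `|x ord0 i| <= 1.
Proof.
move=> /hballE; rewrite subr_gt0 => x1.
rewrite -(@expr_le1 _ 2)// real_normK ?num_real//.
by apply: le_trans (sqr_coord_le_dotv x i) (ltW x1).
Qed.

Lemma measurable_defect : measurable_fun setT (defect : E -> R).
Proof.
apply: measurable_funB => //; apply: measurable_sum => i.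
by apply: measurable_funM; exact: measurable_row_coord.
Qed.

Lemma measurable_comp_defect h : continuous h ->
  measurable_fun setT (fun x : E => h (defect x)).
Proof.
move=> ch; apply: (measurableT_comp (continuous_measurable_fun ch)).
exact: measurable_defect.
Qed.

Lemma bounded_comp_defect h : continuous h ->
  exists M : R, forall x : E, hball x -> `|h (defect x)| <= M.
Proof.
move=> ch; have cn : continuous (fun t => `|h t|).
  by move=> t; apply: (continuous_comp (ch t)); exact: norm_continuous.
have [c _ Hc] := @EVT_max R _ 0 1 ler01 (continuous_subspaceT cn).
exists `|h c| => x /hballE x0; apply: Hc.
by rewrite in_itv /= (ltW x0) defect_le1.
Qed.

Lemma hball_measurable : measurable B.
Proof.
rewrite (_ : B = defect @^-1` `]0, +oo[%classic).
  by rewrite -[X in measurable X]setTI; exact: measurable_defect.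
by apply/seteqP; split => x /=; rewrite in_itv/= andbT => /hballE.
Qed.

Lemma hball_finite : (leb B < +oo)%E.
Proof.
have I2 : lebesgue_measure (`[-1, 1]%classic : set R) = 2%:E.
  rewrite lebesgue_measure_itv/= lte_fin ifT; last lra.
  by rewrite -EFinD; congr _%:E; lra.
have [mB rB] := row_box N (fun=> `[-1, 1]%classic : set R) 2 (fun=> measurable_itv _)
  (fun=> I2).
apply: (@le_lt_trans _ _
  (leb [set x : E | forall i, (`[-1, 1]%classic : set R) (x ord0 i)])); last first.
  by rewrite [ltLHS]rB ltry.
apply: le_measure; rewrite ?inE//; first exact: hball_measurable.
move=> x hx i; have := hball_coord x i hx.
by rewrite /= in_itv/= ler_norml.
Qed.

Lemma bounded_integrable f (M : R) : measurable_fun B f ->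
  (forall x, hball x -> `|f x| <= M) -> leb.-integrable B (EFin \o f).
Proof.
move=> mf fM; apply: measurable_bounded_integrable => //.
- exact: hball_measurable.
- exact: hball_finite.
- exists M; split; first exact: num_real.
  by move=> y My x hx; exact: le_trans (fM x hx) (ltW My).
Qed.

Definition shell (a b : R) : set E := [set x | a <= defect x <= b].

Lemma shell_sub a b : 0 < a -> shell a b `<=` B.
Proof. by move=> a0 x /andP[ax _]; apply/hballE; exact: lt_le_trans ax. Qed.

Lemma shell_measurable a b : measurable (shell a b).
Proof.
rewrite (_ : shell a b = defect @^-1` `[a, b]%classic).
  by rewrite -[X in measurable X]setTI; exact: measurable_defect.
by apply/seteqP; split => x /=; rewrite in_itv.
Qed.

Lemma shell_compact a b : 0 < a -> compact (shell a b).
Proof.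
move=> a0; apply: bounded_closed_compact.
  exists 1; split => [|y y1 x /(shell_sub _ _ a0) hx]; first exact: num_real.
  rewrite /Num.norm/= mx_normrE; apply: bigmax_le => [|[j i] _].
    by rewrite (le_trans ler01)// ltW.
  by rewrite /= ord1 (le_trans (hball_coord _ _ hx))// ltW.
rewrite (_ : shell a b = defect @^-1` `[a, b]%classic).
  apply: preimage_closed; last exact: interval_closed.
  by move=> x _; exact: (Ck_defect 0).
by apply/seteqP; split => x /=; rewrite in_itv.
Qed.

(** Since [f] lives on a compact shell, on which [g] is square integrable, [M * (1 + g^2)], with
    [g^2] cut off outside the shell, dominates the product; this uses [|g| <= 1 + g^2]. *)
Lemma L2_loc_bounded_integrable g f a b (M : R) : 0 < a ->
  L2_loc g -> measurable_fun B f ->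
  (forall x, hball x -> `|f x| <= M) -> (forall x, ~ shell a b x -> f x = 0) ->
  leb.-integrable B (EFin \o (fun x => g x * f x)).
Proof.
move=> a0 [mg ig] mf fM f0; have mH := hball_measurable.
have := ig _ (shell_compact a b a0) (shell_sub a b a0).
move=> /(integrable_mkcond _ (shell_measurable a b)).1.
move=> /(@integrableS _ _ _ _ _ B _ measurableT mH (@subsetT _ _)) i2.
have i1 : leb.-integrable B (EFin \o (fun=> 1 : R)).
  by apply: (@bounded_integrable _ 1) => // x _; rewrite normr1.
apply: (le_integrable mH _ _ (integrableZl mH M (integrableD mH i1 i2))).
  by apply/measurable_EFinP; exact: measurable_funM.
move=> x hx /=; rewrite patchE; have M0 : 0 <= M by exact: le_trans (fM x hx).
case: ifPn => [_|]; last first.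
  by rewrite notin_setE => /f0 ->; rewrite mulr0 normr0 abse_ge0.
rewrite -EFinD -EFinM lee_fin [leRHS]ger0_norm ?mulr_ge0 ?addr_ge0 ?sqr_ge0//.
rewrite normrM mulrC ler_pM//; first exact: fM.
rewrite -[X in _ + X](@real_normK _ (g x)) ?num_real//.
by have := sqr_ge0 (`|g x| - 1); nra.
Qed.

(** Balls of the sup norm are cubes, so [A] contains a closed cube of side [e] centred at [x], of
    measure [e^N]. *)
Lemma open_measure_neq0 (A : set E) x : measurable A -> nbhs x A ->
  leb A != 0%E.
Proof.
move=> mA /nbhs_ballP[e /= e0 xA].
(* [row_box] wants sides indexed by [nat]; the coordinates of [x] are extended by 0 beyond [N]. *)
pose c (j : nat) : R := if insub j is Some i then x ord0 i else 0.
have Ie j : lebesgue_measure (`[c j - e / 2, c j + e / 2]%classic : set R) = e%:E.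
  rewrite lebesgue_measure_itv/= lte_fin ifT; last by lra.
  by rewrite -EFinD; congr _%:E; lra.
have [mB rB] := row_box N _ e (fun=> measurable_itv _) Ie.
set Q := [set y : E | _] in mB rB.
have QA : Q `<=` A.
  move=> y Qy; apply: xA; split => // j i; rewrite ord1; have := Qy i.
  rewrite /c valK /= in_itv /= -ball_normE /= => /andP[y1 y2].
  by rewrite ltr_norml; apply/andP; split; lra.
apply/eqP => A0; have : (leb Q <= leb A)%E by apply: le_measure; rewrite ?inE.
have -> : leb A = 0%E by exact: A0.
have -> : leb Q = (e ^+ N)%:E by exact: rB.
by rewrite leNgt lte_fin exprn_gt0.
Qed.

End ball.

(** * The radial test function *)

Section profile.
Context {R : realType}.
Implicit Types (a t : R) (k n : nat).

(** Dividing by [a^2] makes the parabola scale invariant: at [t = a * s] it equals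
    [(s - 1) * (2 - s)], with maximum 1/4 whatever [a] is. This is the source of a constant
    independent of [a]. *)
Definition bump a t : R := (t - a) * (2 * a - t) / a ^+ 2.
Definition bump1 a t : R := (3 * a - 2 * t) / a ^+ 2.

(** The next two functions are its first and second derivatives: [expinv 0] differentiates to
    [expinv 2], and [expinv 2] to [expinv 4 - 2 * expinv 3]. *)
Definition profile a t : R := expinv 0 (bump a t).
Definition profile1 a t : R := expinv 2 (bump a t) * bump1 a t.
Definition profile2 a t : R :=
  (expinv 4 (bump a t) - 2 * expinv 3 (bump a t)) * bump1 a t ^+ 2
  - 2 / a ^+ 2 * expinv 2 (bump a t).

(* In dimension [n + 2] the field [conf^n * grad phi], whose divergence is
   [conf^(n+2)] times the hyperbolic Laplacian of [phi = profile a (1 - |x|^2)],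
   is [flux n a (1 - |x|^2) * x]. *)
Definition flux n a t : R := (-2 * 2 ^+ n) * (profile1 a t / t ^+ n).

Lemma bump_gt0 a t : 0 < a -> (0 < bump a t) = (a < t < 2 * a).
Proof.
move=> a0; rewrite /bump pmulr_lgt0 ?invr_gt0 ?exprn_gt0//.
apply/idP/idP => [H|/andP[H1 H2]]; last by apply: mulr_gt0; lra.
by apply/andP; split; nra.
Qed.

Lemma expinv_bump_eq0 m a t : 0 < a -> ~~ (a < t < 2 * a) ->
  expinv m (bump a t) = 0.
Proof. by move=> a0; rewrite -bump_gt0// /expinv => /negbTE ->. Qed.

Lemma is_derive_bump a t : is_derive t 1 (bump a) (bump1 a t).
Proof.
pose p : {poly R} := (a ^+ 2)^-1 *: (('X - a%:P) * ((2 * a)%:P - 'X)).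
have E : bump a = horner p.
  apply/funext => x.
  by rewrite /p !(hornerZ, hornerM, hornerD, hornerN, hornerX, hornerC) /bump; ring.
rewrite E; apply: (is_derive_eq (is_derive_poly p t)).
by rewrite /p !(derivZ, derivM, derivD, derivN, derivX, derivC)
  !(hornerZ, hornerM, hornerD, hornerN, hornerX, hornerC) /bump1; ring.
Qed.

Lemma is_derive_bump1 a t : is_derive t 1 (bump1 a) (- 2 / a ^+ 2).
Proof.
pose p : {poly R} := (a ^+ 2)^-1 *: ((3 * a)%:P - 2 *: 'X).
have E : bump1 a = horner p.
  apply/funext => x.
  by rewrite /p !(hornerZ, hornerD, hornerN, hornerX, hornerC) /bump1; ring.
rewrite E; apply: (is_derive_eq (is_derive_poly p t)).
by rewrite /p !(derivZ, derivM, derivD, derivN, derivX, derivC)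
  !(hornerZ, hornerM, hornerD, hornerN, hornerX, hornerC); ring.
Qed.

Lemma C1k_bump1 k a : C1k k (bump1 a).
Proof.
case: k => [t|k]; first exact: is_derive_continuous (is_derive_bump1 a t).
exists (fun=> - 2 / a ^+ 2); split; last exact: C1k_cst.
exact: is_derive_bump1.
Qed.

Lemma C1k_bump k a : C1k k (bump a).
Proof.
case: k => [t|k]; first exact: is_derive_continuous (is_derive_bump a t).
by exists (bump1 a); split; [exact: is_derive_bump|exact: C1k_bump1].
Qed.

Lemma C1k_profile k a : C1k k (profile a).
Proof. exact: (C1k_comp _ _ _ (C1k_expinv k 0) (C1k_bump k a)). Qed.

Lemma is_derive_profile a t : is_derive t 1 (profile a) (profile1 a t).
Proof.
have := is_derive1_comp (is_derive_expinv 0 (bump a t)) (is_derive_bump a t).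
by rewrite oppr0 mul0r add0r.
Qed.

Lemma is_derive_profile1 a t : is_derive t 1 (profile1 a) (profile2 a t).
Proof.
have D := is_derive1_comp (is_derive_expinv 2 (bump a t)) (is_derive_bump a t).
apply: (is_derive_eq (is_deriveM D (is_derive_bump1 a t))).
by rewrite /profile2 /GRing.scale /=; ring.
Qed.

Lemma C1k_profile1 k a : C1k k (profile1 a).
Proof.
apply: C1kM; last exact: C1k_bump1.
exact: (C1k_comp _ _ _ (C1k_expinv k 2) (C1k_bump k a)).
Qed.

Lemma profile_eq0 a t : 0 < a -> ~~ (a < t < 2 * a) -> profile a t = 0.
Proof. exact: expinv_bump_eq0. Qed.

Lemma profile1_eq0 a t : 0 < a -> ~~ (a < t < 2 * a) -> profile1 a t = 0.
Proof. by move=> a0 ta; rewrite /profile1 expinv_bump_eq0// mul0r. Qed.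

Lemma profile_gt0 a t : 0 < a -> a < t < 2 * a -> 0 < profile a t.
Proof.
by move=> a0; rewrite -bump_gt0// /profile /expinv => ->; rewrite expr0 mul1r expR_gt0.
Qed.

Lemma profile_ge0 a t : 0 <= profile a t.
Proof. exact: expinv_ge0. Qed.

Lemma C1k_flux k n a : 0 < a -> C1k k (flux n a).
Proof.
move=> a0; apply: C1kM; first exact: C1k_cst.
apply: (C1k_divX _ _ _ _ a0); last exact: C1k_profile1.
by move=> t ta; rewrite profile1_eq0// negb_and -leNgt (ltW ta).
Qed.

(** The volume density [conf^n] blows up at the boundary [t = 0], but the profile vanishes for
    [t < a]. *)
Lemma continuous_weighted_profile n a : 0 < a ->
  continuous (fun t => profile a t * (2 / t) ^+ n).
Proof.
move=> a0; have C : C1k 0 (fun t => profile a t / t ^+ n).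
  apply: (C1k_divX _ _ _ _ a0); last exact: C1k_profile.
  by move=> t ta; rewrite profile_eq0// negb_and -leNgt (ltW ta).
rewrite (_ : (fun t => _) = fun t => 2 ^+ n * (profile a t / t ^+ n)).
  by apply: (C1kM 0) => //; exact: C1k_cst.
by apply/funext => t; rewrite expr_div_n; ring.
Qed.

Lemma is_derive_flux n a t : 0 < t ->
  is_derive t 1 (flux n a)
    (-2 * 2 ^+ n * ((profile2 a t - n%:R * (profile1 a t / t)) / t ^+ n)).
Proof.
move=> t0; have tn0 : t != 0 by rewrite gt_eqF.
have DX : is_derive t 1 ((fun x : R => x^-1) ^+ n) _ :=
  @is_deriveX R R (fun x : R => x^-1) n t 1 _ (is_derive_inv t tn0).
have D := is_deriveM (is_derive_cst (-2 * 2 ^+ n : R) t 1)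
  (is_deriveM (is_derive_profile1 a t) DX).
have E : flux n a = (cst (-2 * 2 ^+ n) * (profile1 a * (fun x : R => x^-1) ^+ n)).
  by apply/funext => x; rewrite /flux !fctE exprVn.
rewrite E; apply: (is_derive_eq D); rewrite /GRing.scale /= !fctE.
case: n {DX D E} => [|n]; first by rewrite !expr0 invr1; ring.
rewrite /= !exprVn !exprS; field.
by rewrite tn0 expf_neq0.
Qed.

(* With [q = bump a t] and [tau = a * bump1 a t] one has [tau^2 = 1 - 4 q].  The
   left-hand side is at most [- tau^2 + M q^2] with [M = 5 n + 9], and
   [4 q - 1 + M q^2 <= (M + 8)^2 q^4 / 2] by completing squares twice. *)
Lemma flux_ineq_core (n : R) a t q tau : 0 <= n -> 0 < a <= 4^-1 ->
  a < t < 2 * a -> 0 < q -> tau ^+ 2 = 1 - 4 * q ->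
  2 * (n + 2) * q ^+ 2 * (a * tau)
    - 4 * (1 - t) * ((1 - 2 * q) * tau ^+ 2 - 2 * q ^+ 2 - n * q ^+ 2 * (tau * (a / t)))
  <= 4 * ((5 * n + 17) ^+ 2 / 2) * (a / t) ^+ 2 * q ^+ 4.
Proof.
move=> n0 /andP[a0 a4] /andP[at1 at2] q0 tauE.
have t0 : 0 < t by exact: lt_trans at1.
have q4 : q <= 4^-1 by have := sqr_ge0 tau; lra.
have [tau1 tau2] : - 1 <= tau /\ tau <= 1.
  by have := sqr_ge0 tau; split; nra.
set r := a / t.
have [r1 r2] : 2^-1 <= r /\ r <= 1.
  by rewrite ler_pdivlMr// ler_pdivrMr//; split; lra.
have A1 : 2 * (n + 2) * q ^+ 2 * (a * tau) <= (n + 2) * q ^+ 2 / 2.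
  have : a * tau <= 4^-1 by nra.
  have : 0 <= 2 * (n + 2) * q ^+ 2 by apply: mulr_ge0 (sqr_ge0 q); lra.
  by nra.
have A2 : n * q ^+ 2 * (tau * r) <= n * q ^+ 2.
  have : tau * r <= 1 by nra.
  have : 0 <= n * q ^+ 2 := mulr_ge0 n0 (sqr_ge0 q).
  by nra.
have A3 : 2^-1 * tau ^+ 2 <= (1 - 2 * q) * tau ^+ 2.
  by rewrite ler_wpM2r ?sqr_ge0//; lra.
(* As [0 < t < 1/2], the factor [4 * (1 - t)] lies between 2 and 4: the lower bound serves the
   [tau^2] term, the upper one the terms in [q^2]. *)
have A4 : - (4 * (1 - t) * ((1 - 2 * q) * tau ^+ 2 - 2 * q ^+ 2 - n * q ^+ 2 * (tau * r)))
    <= - tau ^+ 2 + 8 * q ^+ 2 + 4 * (n * q ^+ 2).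
  have X : 2^-1 * tau ^+ 2 - 2 * q ^+ 2 - n * q ^+ 2 <=
    (1 - 2 * q) * tau ^+ 2 - 2 * q ^+ 2 - n * q ^+ 2 * (tau * r) by lra.
  have T1 : 0 <= 4 * (1 - t) by lra.
  have := ler_wpM2l T1 X.
  have : 0 <= (2 - 4 * t) / 2 * tau ^+ 2 by apply: mulr_ge0 (sqr_ge0 tau); lra.
  have : 0 <= t * (2 * q ^+ 2 + n * q ^+ 2).
    apply: mulr_ge0 (ltW t0) _; apply: addr_ge0 (mulr_ge0 n0 (sqr_ge0 q)).
    by apply: mulr_ge0 (sqr_ge0 q); lra.
  by nra.
have A5 : (5 * n + 17) ^+ 2 / 2 * q ^+ 4 <= 4 * ((5 * n + 17) ^+ 2 / 2) * r ^+ 2 * q ^+ 4.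
  have : 0 <= (5 * n + 17) ^+ 2 / 2 * q ^+ 4.
    by apply: mulr_ge0 (exprn_ge0 _ (ltW q0)); apply: divr_ge0 (sqr_ge0 _) _; lra.
  have : 4^-1 <= r ^+ 2 by nra.
  by nra.
have A6 : 0 <= ((5 * n + 17) * q ^+ 2 - 1) ^+ 2 by exact: sqr_ge0.
have A7 : 0 <= (4 * q - 1) ^+ 2 by exact: sqr_ge0.
have A8 : 0 <= n * q ^+ 2 := mulr_ge0 n0 (sqr_ge0 q).
apply: le_trans A5.
(* Discarding the square [A6] leaves [(5 n + 17) q^2 - 1/2] on the right. Against the bound
   [4 q - 1 + (5 n + 9) q^2] from [A1], [A4] and [A8], what remains is [4 q - 1/2 <= 8 q^2], that is
   [A7]. *)
have -> : (5 * n + 17) ^+ 2 / 2 * q ^+ 4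
  = (((5 * n + 17) * q ^+ 2 - 1) ^+ 2 + 2 * ((5 * n + 17) * q ^+ 2) - 1) / 2 by field.
by have := sqr_ge0 q; nra.
Qed.

(** This is [- Delta phi <= Lambda phi] multiplied by [conf^(n+2)]: with [t = 1 - |x|^2], the
    left-hand side is minus the divergence of the flux field. Outside [a < t < 2 a] both sides
    vanish; inside, it is [flux_ineq_core] times a positive factor. *)
Lemma flux_ineq n a t d : 0 < a <= 4^-1 -> 0 < t ->
  is_derive t 1 (flux n a) d ->
  2 * (1 - t) * d - n.+2%:R * flux n a t
    <= (5 * n%:R + 17) ^+ 2 / 2 * (profile a t * (2 / t) ^+ n.+2).
Proof.
move=> a4 t0 [_ <-]; have a0 : 0 < a by case/andP: a4.
have [_ ->] := is_derive_flux n a t t0.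
have [ta|ta] := boolP (a < t < 2 * a); last first.
  rewrite /flux profile1_eq0// profile_eq0// /profile2 !expinv_bump_eq0//.
  by rewrite !(mul0r, mulr0, subr0).
have q0 : 0 < bump a t by rewrite bump_gt0.
have tauE : (a * bump1 a t) ^+ 2 = 1 - 4 * bump a t.
  by rewrite /bump /bump1; field; rewrite gt_eqF.
have := flux_ineq_core n%:R _ _ _ _ (ler0n _ _) a4 ta q0 tauE.
rewrite /flux /profile /profile1 /profile2 /expinv q0.
move: (bump a t) (bump1 a t) (expR_gt0 (- (bump a t)^-1)) q0 {tauE} => q b.
set e := expR _ => e0 q0 H.
have q'0 : q != 0 by rewrite gt_eqF.
have t'0 : t != 0 by rewrite gt_eqF.
have a'0 : a != 0 by rewrite gt_eqF.
set L := (_ ^+ 2 / 2) in H *.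
(* The factor cleared in [flux_ineq_core]: the volume weight, the exponential, the highest power of
   [1 / q], and the [a^2] absorbed by [tau = a * b]. *)
pose c := (2 / t) ^+ n * e / (q ^+ 4 * a ^+ 2).
have c0 : 0 < c by rewrite divr_gt0 ?mulr_gt0 ?exprn_gt0 ?divr_gt0.
have := ler_wpM2l (ltW c0) H; congr (_ <= _).
  rewrite /c expr_div_n -[n.+2%:R]natr1 -[n.+1%:R]natr1; field.
  by rewrite expf_neq0 ?t'0 ?q'0 ?a'0.
rewrite /c !exprS expr_div_n; field.
by rewrite expf_neq0 ?t'0 ?q'0 ?a'0.
Qed.

End profile.

(** * Integrals over the ball: finite sums, integrability and strict positivity *)

Lemma Rintegral_sum d (T : measurableType d) (R : realType)
    (mu : {measure set T -> \bar R}) (D : set T) (I : Type) (r : seq I)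
    (f : I -> T -> R) :
  measurable D -> (forall i, mu.-integrable D (EFin \o f i)) ->
  mu.-integrable D (EFin \o (fun x => \sum_(i <- r) f i x)) /\
  \int[mu]_(x in D) (\sum_(i <- r) f i x) = \sum_(i <- r) \int[mu]_(x in D) f i x.
Proof.
move=> mD fi; elim: r => [|i r [IH1 IH2]].
  rewrite big_nil (_ : (fun x => _) = fun=> 0).
    by split; [exact: integrable0|rewrite /Rintegral integral0].
  by apply/funext => x; rewrite big_nil.
rewrite big_cons -IH2 -RintegralD//
  (_ : (fun x => _) = fun x => f i x + \sum_(j <- r) f j x).
  by split=> //; exact: (integrableD mD (fi i) IH1).
by apply/funext => x; rewrite big_cons.
Qed.

Section ball_integrals.
Context {R : realType} {N : nat}.
Notation E := 'rV[R]_N.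
Notation leb := (lebesgue_row R N).
Notation B := (@hball R N).

Lemma integrable_mul_comp_defect (f : E -> R) (M : R) (h : R -> R) :
  measurable_fun B f -> (forall x, B x -> `|f x| <= M) -> continuous h ->
  leb.-integrable B (EFin \o (fun x => f x * h (defect x))).
Proof.
move=> mf fM ch; have [M' hM'] := bounded_comp_defect (N := N) h ch.
apply: (bounded_integrable _ (M * M')).
  apply: measurable_funM => //; apply: measurable_funTS.
  exact: measurable_comp_defect.
by move=> x hx; rewrite normrM ler_pM//; [exact: fM|exact: hM'].
Qed.

(** A nonnegative function with zero integral vanishes almost everywhere, so [A] would be null,
    against [open_measure_neq0]. *)
Lemma Rintegral_hball_gt0 (f : E -> R) (A : set E) (x0 : E) :
  leb.-integrable B (EFin \o f) -> (forall x, B x -> 0 <= f x) ->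
  measurable A -> A `<=` B -> nbhs x0 A -> (forall x, A x -> 0 < f x) ->
  0 < \int[leb]_(x in B) f x.
Proof.
move=> fi f0 mA AB nA fA; rewrite lt_neqAle Rintegral_ge0// andbT.
apply/eqP => /esym If; have mB : measurable B := hball_measurable.
have If0 : (\int[leb]_(x in B) `|(f x)%:E| = 0)%E.
  rewrite (_ : (\int[leb]_(x in B) `|(f x)%:E|)%E = (\int[leb]_(x in B) (f x)%:E)%E).
    by rewrite -[LHS](@fineK R) ?[fine _]If//; exact: integrable_fin_num.
  by apply: eq_integral => x; rewrite inE => /f0 fx; rewrite gee0_abs ?lee_fin.
have mf : measurable_fun B (EFin \o f) by case/integrableP: fi.
have /(ae_eq_integral_abs _ mB mf).1 [Z [mZ Z0 fZ]] := If0.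
have /eqP := open_measure_neq0 A x0 mA nA; apply.
apply: (subset_measure0 mA mZ _ Z0) => x Ax; apply: fZ => /= H.
by have := fA x Ax; have [->] := H (AB x Ax); rewrite ltxx.
Qed.

End ball_integrals.

(** * Radial test functions and their flux fields *)

Section radial_test_functions.
Context {R : realType} {n : nat}.
Notation E := 'rV[R]_n.+2.
Notation leb := (lebesgue_row R n.+2).
Notation B := (@hball R n.+2).
Context (a : R) (a0 : 0 < a).

Definition radial_test (x : E) : R := profile a (defect x).
Definition flux_field (i : 'I_n.+2) (x : E) : R := flux n a (defect x) * x ord0 i.

Lemma notin_shell (x : E) : ~ shell a (2 * a) x -> ~~ (a < defect x < 2 * a).
Proof.
by move=> H; apply/negP => /andP[h1 h2]; apply: H; rewrite /shell /= !ltW.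
Qed.

Lemma test_function_radial_test : test_function radial_test.
Proof.
split; first by move=> k; exact: (Ck_comp _ _ _ (C1k_profile k a) (Ck_defect k)).
exists (shell a (2 * a)); split; [exact: shell_compact|exact: shell_sub|].
by move=> x /notin_shell; exact: profile_eq0.
Qed.

Lemma flux_field_eq0 i x : ~ shell a (2 * a) x -> flux_field i x = 0.
Proof.
by move=> /notin_shell H; rewrite /flux_field /flux profile1_eq0// !(mul0r, mulr0).
Qed.

Lemma test_function_flux_field i : test_function (flux_field i).
Proof.
split.
  move=> k; apply: CkM; last exact: Ck_coord.
  exact: (Ck_comp _ _ _ (C1k_flux k n a a0) (Ck_defect k)).
exists (shell a (2 * a)); split; [exact: shell_compact|exact: shell_sub|].
exact: flux_field_eq0.
Qed.

Lemma pderiv_radial_test i x :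
  pderiv i radial_test x = profile1 a (defect x) * (- 2 * x ord0 i).
Proof.
have [_ ->] := pderiv_comp i _ _ _ _ (is_derive_profile a (defect x))
  (differentiable_defect x).
by rewrite pderiv_defect.
Qed.

Lemma pderiv_flux_field i x (d : R) : is_derive (defect x) 1 (flux n a) d ->
  pderiv i (flux_field i) x = flux n a (defect x) + (- 2 * x ord0 i ^+ 2) * d.
Proof.
move=> dF; have [D P] := pderiv_comp i _ _ _ _ dF (differentiable_defect x).
rewrite (pderivM i _ _ _ D (differentiable_coord _ _ _)) P pderiv_defect pderiv_coord.
rewrite eqxx /=.
by ring.
Qed.

Lemma sum_pderiv_flux_field x (d : R) : is_derive (defect x) 1 (flux n a) d ->
  \sum_i pderiv i (flux_field i) x =
  n.+2%:R * flux n a (defect x) - 2 * (1 - defect x) * d.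
Proof.
move=> dF; under eq_bigr do rewrite (pderiv_flux_field _ _ _ dF).
rewrite big_split /= sumr_const card_ord -mulr_suml -mulr_sumr -[_ *+ _]mulr_natl.
rewrite /defect (_ : dotv x x = \sum_i x ord0 i ^+ 2); first by ring.
by apply: eq_bigr => i _; rewrite expr2.
Qed.

(** The two raised indices give [conf^-4], the metric [conf^2] and the volume [conf^(n+2)]; the
    remaining [conf^n] turns the Euclidean gradient of the test function into the flux field. *)
Lemma hmetric_hgrad_radial_test (G : E -> E) x : B x ->
  hmetric x (hgrad G x) (hgrad (egrad radial_test) x) * conf x ^+ n.+2 =
  \sum_i G x ord0 i * flux_field i x.
Proof.
move=> /hballE s0; rewrite /hmetric /dotv mulr_sumr mulr_suml.
apply: eq_bigr => i _; rewrite !mxE pderiv_radial_test /flux_field /flux.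
rewrite conf_defect !exprS !expr0 expr_div_n; field.
by rewrite expf_neq0 ?gt_eqF.
Qed.

Lemma nbhs_shell_nonempty : a <= 4^-1 ->
  exists x : E, nbhs x [set y : E | a < defect y < 2 * a].
Proof.
move=> a4; have a32 : a < 3 / 2 * a < 2 * a.
  by have p0 := a0; apply/andP; split; lra.
(* A point on the first axis whose defect is [3 a / 2], the midpoint of the interval. *)
pose c := Num.sqrt (1 - 3 / 2 * a).
pose x : E := c *: delta_mx ord0 ord0; exists x.
have dx : defect x = 3 / 2 * a.
  rewrite /defect /dotv (bigD1 ord0)//= big1 => [|i i0].
    by rewrite !mxE !eqxx mulr1 addr0 -expr2 sqr_sqrtr; lra.
  by rewrite !mxE (negbTE i0) andbF !mulr0.
have ab : nbhs (defect x) [set t | t \in `]a, 2 * a[].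
  by apply: near_in_itvoo; rewrite in_itv /= dx.
have xab : nbhs x (defect @^-1` [set t | t \in `]a, 2 * a[]) := Ck_defect 0 x _ ab.
by apply: filterS xab => y /=; rewrite in_itv.
Qed.

End radial_test_functions.

(** * The weak equation tested with a radial function *)

Section weak_identity.
Context {R : realType} {n : nat}.
Notation E := 'rV[R]_n.+2.
Notation leb := (lebesgue_row R n.+2).
Notation B := (@hball R n.+2).

(** Green's formula. The witness [S] is the divergence of the flux field, that is [conf^(n+2)] times
    the hyperbolic Laplacian of the radial function. Each component of the flux field is itself a
    test function, so the definition of the weak gradient moves the derivative off [u]. *)
Lemma hint_grad_radial_test (u : E -> R) (G : E -> E) (a C : R) : 0 < a ->
  H1_loc_with u G -> (forall x, B x -> `|u x| <= C) ->
  exists S : E -> R,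
    [/\ leb.-integrable B (EFin \o (fun x => u x * S x)),
        hint (fun x => hmetric x (hgrad G x) (hgrad (egrad (radial_test a)) x)) =
          - \int[leb]_(x in B) (u x * S x)
      & forall x, B x -> a <= 4^-1 ->
          - S x <= (5 * n%:R + 17) ^+ 2 / 2 * (radial_test a x * conf x ^+ n.+2)].
Proof.
move=> a0 [[mu _] LG wG] uC; have mB : measurable B := hball_measurable.
have [d [dF cd]] := C1k_flux 1 n a a0.
have cF : continuous (flux n a) := C1k_flux 0 n a a0.
have mx2 (i : 'I_n.+2) : measurable_fun B (fun x : E => - 2 * x ord0 i ^+ 2).
  apply: measurable_funM => //; apply: measurable_funX.
  by apply: measurable_funTS; exact: measurable_row_coord.
have iS i : leb.-integrable B (EFin \o (fun x => u x * pderiv i (flux_field a i) x)).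
  have I1 := integrable_mul_comp_defect u C _ mu uC cF.
  have I2 : leb.-integrable B
      (EFin \o (fun x => (u x * (- 2 * x ord0 i ^+ 2)) * d (defect x))).
    apply: (integrable_mul_comp_defect _ (C * 2)) => //; first exact: measurable_funM.
    move=> x hx; rewrite normrM ler_pM//; first exact: uC.
    have := hball_coord x i hx; rewrite normrM normrN normrX => x1.
    have -> : `|2 : R| = 2 by exact: ger0_norm.
    by have := normr_ge0 (x ord0 i); nra.
  have E : (fun x => u x * pderiv i (flux_field a i) x) = fun x =>
      u x * flux n a (defect x) + (u x * (- 2 * x ord0 i ^+ 2)) * d (defect x).
    by apply/funext => x; rewrite (pderiv_flux_field _ _ _ _ (dF _)); ring.
  by rewrite E; exact: (integrableD mB I1 I2).
(* [G] is only locally square integrable, so the support of the flux field in the shell is essential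
   here. *)
have iG i : leb.-integrable B (EFin \o (fun x => G x ord0 i * flux_field a i x)).
  have [M hM] := bounded_comp_defect (N := n.+2) _ cF.
  apply: (L2_loc_bounded_integrable _ _ a (2 * a) M a0 (LG i)).
  - apply: measurable_funTS; apply: measurable_funM; last exact: measurable_row_coord.
    exact: measurable_comp_defect.
  - move=> x hx; rewrite /flux_field normrM -[M]mulr1 ler_pM//.
    + exact: hM.
    + exact: hball_coord.
  - by move=> x; exact: flux_field_eq0.
exists (fun x => \sum_i pderiv i (flux_field a i) x); split.
- under eq_fun do rewrite mulr_sumr.
  by have [] := Rintegral_sum _ _ _ leb B _ (index_enum _) _ mB iS.
- rewrite /hint.
  transitivity (\int[leb]_(x in B) (\sum_i G x ord0 i * flux_field a i x)).
    by apply: eq_Rintegral => x; rewrite inE => hx; exact: hmetric_hgrad_radial_test.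
  have [_ ->] := Rintegral_sum _ _ _ leb B _ (index_enum _) _ mB iG.
  transitivity (- \int[leb]_(x in B) (\sum_i u x * pderiv i (flux_field a i) x)).
    have [_ ->] := Rintegral_sum _ _ _ leb B _ (index_enum _) _ mB iS.
    rewrite -sumrN; apply: eq_bigr => i _.
    by rewrite (wG _ i (test_function_flux_field a a0 i)) opprK.
  by congr (- _); apply: eq_Rintegral => x _; rewrite mulr_sumr.
- move=> x /hballE s0 a4; rewrite (sum_pderiv_flux_field a x _ (dF _)) opprB conf_defect.
  by apply: flux_ineq => //; rewrite a0.
Qed.

(** The threshold is the constant of [flux_ineq] plus 1, and the surplus 1 produces the
    contradiction. The bound [C] provides integrability of every term, so that the weak equation can
    be merged into one integral. *)
Lemma potential_not_large_on_shell (lambda theta p C a : R) (u : E -> R) :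
  0 < a <= 4^-1 -> 1 < p ->
  weak_solution lambda theta p u -> (forall x, B x -> 0 < u x) ->
  (forall x, B x -> u x <= C) ->
  ~ (forall x, B x -> a < defect x < 2 * a ->
      (5 * n%:R + 17) ^+ 2 / 2 + 1 <=
        lambda + theta * ln (u x ^+ 2) + `|u x| `^ (p - 1)).
Proof.
move=> /andP[a0 a4] p1 [G [HG weak]] u0 uC V.
have mB : measurable B := hball_measurable.
have mu : measurable_fun B u by case: HG => -[].
have nu x : B x -> `|u x| = u x by move=> /u0 /ltW; exact: ger0_norm.
have nuC x : B x -> `|u x| <= C by move=> hx; rewrite nu// uC.
pose w (x : E) := radial_test a x * conf x ^+ n.+2.
pose W t := profile a t * (2 / t) ^+ n.+2.
have wW x : w x = W (defect x) by rewrite /w /W conf_defect.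
have cW : continuous W := continuous_weighted_profile n.+2 a a0.
have w0 x : B x -> 0 <= w x.
  move=> /hballE s0; rewrite wW /W mulr_ge0 ?profile_ge0//.
  by rewrite exprn_ge0// divr_ge0// ltW.
pose f2 (x : E) := u x * ln (u x ^+ 2); pose f3 (x : E) := `|u x| `^ (p - 1) * u x.
have i1 : leb.-integrable B (EFin \o (fun x => u x * w x)).
  by under eq_fun do rewrite wW; exact: (integrable_mul_comp_defect _ _ _ mu nuC cW).
have i2 : leb.-integrable B (EFin \o (fun x => f2 x * w x)).
  under eq_fun do rewrite wW.
  (* From [ln s < s] at [s = u] and [s = 1 / u] one gets [-1 < u ln u <= u^2 <= C^2], which controls
     the logarithm also where [u] is small. *)
  apply: (integrable_mul_comp_defect _ (2 * C ^+ 2 + 2)) => //.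
    apply: measurable_funM => //.
    exact: (measurableT_comp (@measurable_ln R) (measurable_funX 2 mu)).
  move=> x hx; have ux := u0 x hx; rewrite /f2 lnXn// mulrnAr -mulr_natl.
  have l1 := ln_sublinear ux.
  have : ln (u x)^-1 < (u x)^-1 by rewrite ln_sublinear ?invr_gt0.
  rewrite lnV ?posrE// -(ltr_pM2l ux) mulfV ?gt_eqF// mulrN => l3.
  have uC2 : u x ^+ 2 <= C ^+ 2.
    by rewrite ler_pXn2r ?nnegrE ?(ltW ux)// ?uC// (le_trans (ltW ux) (uC x hx)).
  have : u x * ln (u x) <= u x ^+ 2 by rewrite expr2 ler_wpM2l// ltW.
  by move=> l4; rewrite ler_norml; apply/andP; split; have := sqr_ge0 C; nra.
have i3 : leb.-integrable B (EFin \o (fun x => f3 x * w x)).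
  under eq_fun do rewrite wW.
  apply: (integrable_mul_comp_defect _ (C `^ (p - 1) * C)) => //.
    apply: measurable_funM => //.
    apply: (measurableT_comp (@measurable_powR R (p - 1))).
    exact: (measurableT_comp (@normr_measurable R setT) mu).
  move=> x hx; rewrite /f3 normrM ger0_norm ?powR_ge0// ler_pM ?powR_ge0 ?nuC//.
  have C0 : 0 <= C by exact: le_trans (normr_ge0 _) (nuC x hx).
  by rewrite ge0_ler_powR ?nnegrE ?nuC// subr_ge0 ltW.
have [S [iS HS Sw]] := hint_grad_radial_test u G a C a0 HG nuC.
have := weak _ (test_function_radial_test a a0); rewrite HS.
have -> : hint (fun x => u x * radial_test a x) = \int[leb]_(x in B) (u x * w x).
  by apply: eq_Rintegral => x _; rewrite /w mulrA.
have -> : hint (fun x => radial_test a x * (u x * ln (u x ^+ 2))) =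
    \int[leb]_(x in B) (f2 x * w x).
  by apply: eq_Rintegral => x _; rewrite /w /f2; ring.
have -> : hint (fun x => radial_test a x * (`|u x| `^ (p - 1) * u x)) =
    \int[leb]_(x in B) (f3 x * w x).
  by apply: eq_Rintegral => x _; rewrite /w /f3; ring.
move=> eqn.
have j1 : leb.-integrable B (EFin \o (fun x => lambda * (u x * w x))) :=
  integrableZl mB lambda i1.
have j2 : leb.-integrable B (EFin \o (fun x => theta * (f2 x * w x))) :=
  integrableZl mB theta i2.
have j12 : leb.-integrable B (EFin \o (fun x =>
  lambda * (u x * w x) + theta * (f2 x * w x))) :=
  integrableD mB j1 j2.
have j123 : leb.-integrable B (EFin \o (fun x =>
  lambda * (u x * w x) + theta * (f2 x * w x) + f3 x * w x)) := integrableD mB j12 i3.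
have jF : leb.-integrable B (EFin \o (fun x =>
  u x * S x + (lambda * (u x * w x) + theta * (f2 x * w x) + f3 x * w x))) :=
  integrableD mB iS j123.
(* The weak equation in the form [int u (S + V w) = 0], where [V] is the potential and [w] the
   weighted test function. *)
have : \int[leb]_(x in B) (u x * S x +
   (lambda * (u x * w x) + theta * (f2 x * w x) + f3 x * w x)) = 0.
  rewrite (RintegralD mB iS j123) (RintegralD mB j12 i3) (RintegralD mB j1 j2).
  by rewrite !RintegralZl//; lra.
have [x0 nx0] := nbhs_shell_nonempty (n := n) a a0 a4.
pose A := [set x : E | a < defect x < 2 * a].
have mA : measurable A.
  rewrite (_ : A = defect @^-1` `]a, 2 * a[%classic).
    by rewrite -[X in measurable X]setTI; exact: measurable_defect.
  by apply/seteqP; split => x /=; rewrite in_itv.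
have AB : A `<=` B.
  by move=> x /andP[ax _]; apply/hballE; exact: lt_trans ax.
suff H : 0 < \int[leb]_(x in B) (u x * w x).
  move=> F0; suff : \int[leb]_(x in B) (u x * w x) <= 0 by rewrite leNgt H.
  (* Pointwise [u w <= u (S + V w)]: on the shell because [- S <= Lambda w] and [V >= Lambda + 1],
     elsewhere because [w = 0] and [S >= 0]. *)
  rewrite -F0; apply: (le_Rintegral mB i1 jF) => x hx.
  have -> : u x * S x + (lambda * (u x * w x) + theta * (f2 x * w x) + f3 x * w x) =
      u x * (S x + (lambda + theta * ln (u x ^+ 2) + `|u x| `^ (p - 1)) * w x).
    by rewrite /f2 /f3; ring.
  rewrite ler_wpM2l ?(ltW (u0 x hx))//.
  have := Sw x hx a4; rewrite -/(w x) => Sx.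
  have [ax|ax] := boolP (a < defect x < 2 * a).
    by have := ler_wpM2r (w0 x hx) (V x hx ax); lra.
  have wx0 : w x = 0 by rewrite wW /W profile_eq0// mul0r.
  by move: Sx; rewrite wx0 !mulr0 addr0 oppr_le0.
apply: (Rintegral_hball_gt0 _ A x0) => //.
  by move=> x hx; rewrite mulr_ge0 ?w0// ltW ?u0.
move=> x Ax; have hx := AB x Ax; rewrite mulr_gt0 ?u0// wW mulr_gt0 ?profile_gt0//.
by rewrite exprn_gt0// divr_gt0//; exact/hballE.
Qed.

End weak_identity.

(** * Choice of the shell and conclusion *)

Theorem lemma5p7 (R : realType) (N : nat) (lambda theta p : R)
  (hNp : ((3 <= N)%N /\ 1 < p <= two_star R N - 1) \/ (N = 2%N /\ 1 < p))
  (htheta : theta < 0) :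
  ~ exists u : 'rV[R]_N -> R,
      [/\ weak_solution lambda theta p u,
          (forall x, hball x -> 0 < u x)
        & exists alpha C : R,
            [/\ 0 < alpha, 1 <= C
              & forall x, hball x ->
                  C^-1 * (1 - enorm x ^+ 2) `^ alpha <= u x
                    <= C * (1 - enorm x ^+ 2) `^ alpha]].
Proof.
have [n [nN p1]] : exists n, N = n.+2 /\ 1 < p.
  case: hNp => [[N3 /andP[p1 _]]|[-> p1]]; last by exists 0%N.
  by exists N.-2; split => //; case: N N3 => [|[]].
subst N => -[u [weak u0 [alpha [C [al0 C1 uC]]]]].
have C0 : 0 < C := lt_le_trans ltr01 C1.
have {}uC x : hball x -> u x <= C * defect x `^ alpha.
  by move=> /uC /andP[_]; rewrite enorm_sqr.
pose L : R := (5 * n%:R + 17) ^+ 2 / 2 + 1.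
(* The constants are chosen backwards: [ln u <= - b] makes [theta ln u^2] at least [L + |lambda|];
   [K] solves [ln C - alpha K = - b]; and [2 a <= exp (- K)] forces [ln (defect x) <= - K] on the
   shell. *)
pose b : R := (L + `|lambda|) / (- 2 * theta).
pose K : R := (b + ln C) / alpha.
pose a : R := Num.min 4^-1 (expR (- K) / 2).
have a0 : 0 < a.
  by rewrite lt_min; apply/andP; split; [lra|rewrite divr_gt0 ?expR_gt0].
have a4 : a <= 4^-1 by rewrite ge_min lexx.
have aK : 2 * a <= expR (- K).
  by rewrite mulrC -ler_pdivlMr// ge_min lexx orbT.
apply: (potential_not_large_on_shell lambda theta p C a u) => //.
- by rewrite a0.
- move=> x hx; apply: le_trans (uC x hx) _; rewrite -[leRHS]mulr1 ler_pM2l//.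
  have := hx; move=> /hballE s0.
  apply: (@le_trans _ _ (1 `^ alpha)); last by rewrite powR1.
  by apply: ge0_ler_powR; rewrite ?nnegrE ?defect_le1 ?ltW.
- move=> x hx /andP[s1 s2]; have ux := u0 x hx.
  have s0 : 0 < defect x by exact: lt_trans s1.
  have : ln (u x) <= ln (C * defect x `^ alpha).
    by rewrite ler_ln ?posrE ?mulr_gt0 ?powR_gt0// uC.
  rewrite lnM ?posrE ?powR_gt0// ln_powR.
  have : ln (defect x) <= - K.
    by rewrite -(expRK (- K)) ler_ln ?posrE ?expR_gt0//; exact: le_trans (ltW s2) aK.
  rewrite -(ler_pM2l al0) {1}/K mulrN mulrCA mulfV ?gt_eqF// mulr1 => h1 h2.
  have ub : ln (u x) <= - b by lra.
  have := ler_wnM2l (ltW htheta) ub.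
  have bE : theta * - b = (L + `|lambda|) / 2.
    by rewrite /b; field; rewrite lt_eqF.
  rewrite bE lnXn// => h3.
  (* The power term is nonnegative, and the [|lambda|] built into [b] compensates a negative
     [lambda]. *)
  have := powR_ge0 `|u x| (p - 1); have := ler_norm (- lambda); rewrite normrN -/L.
  by rewrite mulrnAr -mulr_natl; lra.
Qed.
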